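(* For every positive integer $n$, the call $\mathrm{RecAsc}(n,1,1)$ results in exactly $p(n)$ invocations of $\mathrm{RecAsc}$ in total, counting the initial call and all recursive calls.
   Context: $p(n)$ denotes the number of partitions of $n$. The recursive procedure $\mathrm{RecAsc}(n,m,k)$, with precondition $1\le m\le n$, operates on a global array $a$ as follows: 1. $x\leftarrow m$. 2. While $2x\le n$: set $a_k\leftarrow x$; call $\mathrm{RecAsc}(n-x,x,k+1)$; set $x\leftarrow x+1$. 3. $a_k\leftarrow n$. 4. Visit (output) $\langle a_1,\dots,a_k\rangle$. *)

(* Defs.v *)
From HB Require Import structures.
From mathcomp Require Import all_boot.

Set Implicit Arguments.
Unset Strict Implicit.
Unset Printing Implicit Defensive.

Definition is_partition (n : nat) (s : seq nat) : bool :=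
  [&& sorted geq s, all (leq 1) s & sumn s == n].

(* A partition of n has at most n parts, each at most n (see
   [is_partition_bseq]), so counting within this finite type loses nothing. *)
Definition num_partitions (n : nat) : nat :=
  #|[set t : n.-bseq 'I_n.+1 | is_partition n [seq val i | i <- t]]|.

Lemma is_partition_bseq (n : nat) (s : seq nat) :
  is_partition n s -> exists t : n.-bseq 'I_n.+1, [seq val i | i <- t] = s.
Proof.
case/and3P=> _ s_gt0 /eqP sum_s.
have size_s : size s <= n.
  rewrite -sum_s; elim: s s_gt0 {sum_s} => //= x s IHs /andP[x_gt0 /IHs le_s].
  by rewrite -add1n leq_add.
have part_s : all (fun x => x < n.+1) s.
  apply/allP=> x s_x; rewrite ltnS -sum_s (perm_sumn (perm_to_rem s_x)) /=.
  exact: leq_addr.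
have map_s : [seq val i | i <- [seq inord x : 'I_n.+1 | x <- s]] = s.
  rewrite -map_comp map_id_in // => x /(allP part_s); exact: inordK.
have size_t : size [seq inord x : 'I_n.+1 | x <- s] <= n by rewrite size_map.
by exists (Bseq size_t).
Qed.

(* The global array; the cell a_0 is never used. *)
Definition array := nat -> nat.

Definition update (a : array) (k v : nat) : array :=
  fun i => if i == k then v else a i.

Definition prefix_upto (a : array) (k : nat) : seq nat :=
  [seq a i | i <- iota 1 k].

Inductive event : Type :=
  | Invoke of nat & nat & nat
  | Visit of seq nat.

Definition is_invoke (e : event) : bool :=
  if e is Invoke _ _ _ then true else false.

Definition num_invocations (tr : seq event) : nat := count is_invoke tr.

(* Big-step semantics.  [rec_asc n m k a a' tr]: started with array a, the call
   RecAsc(n, m, k) terminates with array a', and tr is the chronological list of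
   all invocations and visits, the nested ones included.
   [rec_asc_while n x k a a' tr] is the same for the while loop of such a call,
   entered with the local variable x. *)
Inductive rec_asc : nat -> nat -> nat -> array -> array -> seq event -> Prop :=
  | RecAscCall n m k a a' tr :
      1 <= m <= n ->
      rec_asc_while n m k a a' tr ->
      rec_asc n m k a (update a' k n)
        (Invoke n m k :: rcons tr (Visit (prefix_upto (update a' k n) k)))
with rec_asc_while :
    nat -> nat -> nat -> array -> array -> seq event -> Prop :=
  | WhileStep n x k a a1 a2 tr1 tr2 :
      2 * x <= n ->
      rec_asc (n - x) x k.+1 (update a k x) a1 tr1 ->
      rec_asc_while n x.+1 k a1 a2 tr2 ->
      rec_asc_while n x k a a2 (tr1 ++ tr2)
  | WhileExit n x k a :
      n < 2 * x ->
      rec_asc_while n x k a a [::].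

(* Main.v *)
(** The invocations made by RecAsc(n, m, k), itself included, are in bijection
    with the nonempty weakly increasing sequences of sum [n] and parts at least
    [m].  The call itself corresponds to the one-term sequence [n]; the loop
    accounts for the sequences of length at least two, its iteration with value
    [x] for those that start with [x].  Such a sequence needs [2 * x <= n], which
    is why the loop may stop where it does.  For [m = 1], reversing the sequences
    gives the partitions of [n]. *)

Require Import Defs.
From mathcomp Require Import all_boot.

Scheme rec_asc_mut := Minimality for rec_asc Sort Prop
  with rec_asc_while_mut := Minimality for rec_asc_while Sort Prop.

(** [path leq m s] makes [s] weakly increasing and bounds its parts below by [m]. The length bound
    [l] is 1 for calls and 2 for loops. *)
Definition asc_comp (l n m : nat) (s : seq nat) : bool :=
  [&& path leq m s, sumn s == n & l <= size s].

(** Cardinality through a duplicate-free list, since [seq nat] is not a finite type. *)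
Definition enumerates {T : eqType} (P : pred T) (c : nat) : Prop :=
  exists L : seq T, [/\ uniq L, size L = c & forall x, (x \in L) = P x].

(** The conjunct [x <= n] guards against truncated subtraction. *)
Lemma asc_comp_cons l n m x s :
  asc_comp l.+1 n m (x :: s) = [&& m <= x, x <= n & asc_comp l (n - x) x s].
Proof.
rewrite /asc_comp /= -andbA ltnS; case: (m <= x) => //=.
case: (leqP x n) => [le_xn | lt_nx] /=; first by rewrite -(eqn_add2l x (sumn s)) subnKC.
by rewrite gtn_eqF ?andbF // ltn_addr.
Qed.

Lemma enumerates_call n m c :
  0 < m <= n -> enumerates (asc_comp 2 n m) c ->
  enumerates (asc_comp 1 n m) c.+1.
Proof.
case/andP=> _ le_mn [L [uniqL sizeL memL]]; exists ([:: n] :: L).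
split=> [||s]; rewrite /= ?sizeL ?uniqL ?memL ?andbT //.
  by rewrite /asc_comp /= !andbF.
rewrite inE memL /asc_comp.
case: s => [|x [|y s]] /=; rewrite ?andbF ?orbF ?andbT //.
  rewrite eqseq_cons eqxx andbT addn0.
  by case: eqP => [->|]; rewrite ?le_mn ?andbF.
by rewrite eqseq_cons andbF.
Qed.

Lemma enumerates_step n x c1 c2 :
  x <= n -> enumerates (asc_comp 1 (n - x) x) c1 ->
  enumerates (asc_comp 2 n x.+1) c2 -> enumerates (asc_comp 2 n x) (c1 + c2).
Proof.
move=> le_xn [L1 [uniq1 size1 mem1]] [L2 [uniq2 size2 mem2]].
have inj_cons : injective (cons x) by move=> s t [].
exists (map (cons x) L1 ++ L2); split=> [||s].
- rewrite cat_uniq map_inj_uniq // uniq1 uniq2 andbT /=.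
  apply/hasPn=> s; rewrite mem2 => asc_s; apply/mapP=> -[t _ def_s].
  by move: asc_s; rewrite def_s asc_comp_cons ltnn.
- by rewrite size_cat size_map size1 size2.
rewrite mem_cat mem2; case: s => [|y s].
  by rewrite /asc_comp !andbF orbF; apply/mapP=> -[].
(* The first term [y] either equals [x], and the sequence lies in the first list, or exceeds [x],
   and it lies in [L2]. *)
rewrite !asc_comp_cons (leq_eqVlt x) [x == y]eq_sym.
case: eqP => [->|ne_yx] /=.
  by rewrite mem_map // mem1 ltnn le_xn orbF.
by rewrite (_ : _ \in map _ _ = false) //; apply/mapP=> -[t _ [/ne_yx]].
Qed.

(** Two terms that are at least [x] already sum to at least [2 * x]. *)
Lemma enumerates_exit n x : n < 2 * x -> enumerates (asc_comp 2 n x) 0.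
Proof.
move=> lt_n2x; exists [::]; split=> // s; rewrite in_nil /asc_comp.
case: s => [|y [|z s]] /=; rewrite ?andbF // andbT; apply/esym/negP.
case/andP=> /and3P[le_xy le_yz _] /eqP sum_n; move: lt_n2x; rewrite ltnNge.
by rewrite -sum_n mul2n -addnn leq_add // (leq_trans (leq_trans le_xy le_yz)) // leq_addr.
Qed.

Lemma rec_asc_enumerates n m k a a' tr :
  rec_asc n m k a a' tr -> enumerates (asc_comp 1 n m) (num_invocations tr).
Proof.
pose Q n x (_ : nat) (_ _ : array) tr :=
  enumerates (asc_comp 2 n x) (num_invocations tr).
move: n m k a a' tr; apply: (rec_asc_mut _ Q); rewrite /Q /num_invocations.
- move=> n m k a a' tr le_mn _ enum_tr /=.
  by rewrite -cats1 count_cat /= !addn0 add1n; apply: enumerates_call.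
- move=> n x k a a1 a2 tr1 tr2 le_2xn _ enum1 _ enum2.
  rewrite count_cat; apply: enumerates_step => //.
  by apply: leq_trans le_2xn; rewrite leq_pmull.
- by move=> n x k _; apply: enumerates_exit.
Qed.

(** The outer induction on [n] serves the recursive calls, as [n - x < n]; the inner one, on a bound
    for [n.+1 - m], serves the loop. *)
Lemma rec_asc_terminates n m k a :
  0 < m <= n -> exists a' tr, rec_asc n m k a a' tr.
Proof.
elim/ltn_ind: n m k a => n IHn m k a le_mn.
suff [a' [tr run]] : exists a' tr, rec_asc_while n m k a a' tr.
  by exists (update a' k n); eexists; apply: RecAscCall run.
case/andP: le_mn => m_gt0 _.
have [d] := ubnP (n.+1 - m); elim: d m a m_gt0 => // d IHd x a x_gt0 lt_d.
case: (leqP (2 * x) n) => [le_2xn | lt_n2x]; last first.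
  by exists a, [::]; apply: WhileExit.
have le_xn : x <= n by apply: leq_trans le_2xn; rewrite leq_pmull.
have [||a1 [tr1 run1]] := IHn (n - x) _ x k.+1 (update a k x).
- by rewrite ltn_subrL x_gt0 (leq_trans x_gt0).
(* The loop guard is the callee's precondition [x <= n - x]. *)
- by rewrite x_gt0 leq_subRL // addnn -mul2n.
have [||a2 [tr2 run2]] := IHd x.+1 a1 => //.
  by rewrite subSS; rewrite subSn // in lt_d.
by exists a2, (tr1 ++ tr2); apply: WhileStep run1 run2.
Qed.

Lemma is_partition_rev n s :
  0 < n -> is_partition n (rev s) = asc_comp 1 n 1 s.
Proof.
move=> n_gt0; rewrite /is_partition /asc_comp rev_sorted all_rev sumn_rev.
rewrite path_sortedE; last exact: leq_trans.
rewrite andbCA -!andbA; do 2!congr (_ && _).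
(* The empty sequence is excluded on the left by its sum 0, as [0 < n]. *)
by case: s => [|x s] /=; rewrite ?andbT // andbF ltn_eqF.
Qed.

(** [L] and the list of reversed partitions are duplicate-free with the same members, so they have
    equal length. *)
Lemma enumerates_num_partitions n c :
  0 < n -> enumerates (asc_comp 1 n 1) c -> c = num_partitions n.
Proof.
move=> n_gt0 [L [uniqL <- memL]]; rewrite /num_partitions cardE.
pose parts (t : n.-bseq 'I_n.+1) := rev [seq val i | i <- t].
rewrite -(size_map parts); apply: perm_size; apply: uniq_perm => //.
  rewrite map_inj_uniq ?enum_uniq // => t u /(can_inj revK).
  by move/(inj_map val_inj)/val_inj.
move=> s; rewrite memL -is_partition_rev //.
apply/idP/mapP=> [part_s | [t]].
  have [t def_t] := is_partition_bseq part_s.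
  by exists t; rewrite ?mem_enum ?inE /parts def_t ?revK.
by rewrite mem_enum inE => part_t ->; rewrite revK.
Qed.

Theorem theorem2p1 (n : nat) (hn : 0 < n) (a : array) :
  (exists (a' : array) (tr : seq event), rec_asc n 1 1 a a' tr) /\
  (forall (a' : array) (tr : seq event),
     rec_asc n 1 1 a a' tr -> num_invocations tr = num_partitions n).
Proof.
split=> [|a' tr /rec_asc_enumerates]; first exact: rec_asc_terminates.
exact: enumerates_num_partitions.
Qed.
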